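(* Let $1\le s\le r$ be integers, and let $\mathcal G$ be the reduced Gröbner basis of $L_{r,s}=\operatorname{Ker}\varphi$ with respect to the reverse lexicographic order on $T$ induced by the order of the variables in which $y_u>y_v$ if $u>_{\mathrm{lex}}v$. Here $\varphi$ is the $K$-algebra homomorphism from $T$ onto the $K$-algebra generated by all squarefree monomials of degree $s$ in $x_1,\ldots,x_r$, with $y_u\mapsto u$. Then the binomials of $\mathcal G$ have squarefree initial monomials and are of degree at most $3$.
   Context: $K$ is a field. $B$ is the set of all squarefree monomials of degree $s$ in $K[x_1,\ldots,x_r]$, $T=K[y_u : u\in B]$ is a polynomial ring, and $\varphi:T\to K[B]\subset K[x_1,\ldots,x_r]$ is given by $y_u\mapsto u$. $>_{\mathrm{lex}}$ is the lexicographic order on monomials with $x_1>\cdots>x_r$. The reverse lexicographic order is the graded reverse lexicographic order. *)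

(* Defs.v *)
From HB Require Import structures.
From mathcomp Require Import all_boot all_order all_algebra.
From mathcomp.multinomials Require Import mpoly.

Set Implicit Arguments.
Unset Strict Implicit.
Unset Printing Implicit Defensive.

Import GRing.Theory.
Local Open Scope ring_scope.

Definition squarefree_mnm n (m : 'X_{1..n}) : bool := [forall i, m i <= 1]%N.

Section MonomialOrders.
Variable n : nat.
Implicit Types a b : 'X_{1..n}.

(* [lex_gt a b] is a >_lex b for x_0 > x_1 > ... > x_(n-1); the degree is not
   compared first.  The order [<=%O] of mpoly.v is degree-lexicographic, despite
   its header, so neither it nor [mlead] is the order required below. *)
Definition lex_gt : rel 'X_{1..n} := fun a b =>
  [exists i : 'I_n,
     (b i < a i)%N && [forall j : 'I_n, (j < i)%N ==> (a j == b j)]].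

(* The order on the variables is given by [vgt], where [vgt i j] means
   'X_i > 'X_j.  At equal degree, a < b iff a has the larger exponent at the
   smallest variable where a and b differ. *)
Definition grevlex_lt (vgt : rel 'I_n) : rel 'X_{1..n} := fun a b =>
  (mdeg a < mdeg b)%N ||
  (mdeg a == mdeg b) &&
    [exists i : 'I_n,
       (b i < a i)%N && [forall j : 'I_n, vgt i j ==> (a j == b j)]].

End MonomialOrders.

Definition ideal_gen (R : comNzRingType) (S : R -> Prop) (p : R) : Prop :=
  exists2 l : seq (R * R),
    (forall c, c \in l -> S c.2) & p = \sum_(c <- l) c.1 * c.2.

Section GroebnerBases.
Variables (K : fieldType) (n : nat) (lt : rel 'X_{1..n}).
Implicit Types (p g h : {mpoly K[n]}) (m : 'X_{1..n}).
Implicit Types (I : {mpoly K[n]} -> Prop) (G : seq {mpoly K[n]}).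

Definition initial_monomial p m : Prop :=
  m \in msupp p /\ (forall m', m' \in msupp p -> m' != m -> lt m' m).

(* Zero has no initial monomial, so it contributes no generator. *)
Definition initial_ideal I : {mpoly K[n]} -> Prop :=
  ideal_gen (fun q => exists p m, [/\ I p, initial_monomial p m & q = 'X_[m]]).

Definition groebner_basis I G : Prop :=
  [/\ forall g, g \in G -> I g,
      0 \notin G
    & forall p, initial_ideal I p <-> initial_ideal (fun g => g \in G) p].

(* [(m <= m')%MM] is divisibility of monomials. *)
Definition reduced_groebner_basis I G : Prop :=
  [/\ groebner_basis I G,
      forall g m, g \in G -> initial_monomial g m -> g@_m = 1
    & forall g h m m', g \in G -> h \in G -> g != h ->
        initial_monomial g m -> m' \in msupp h -> ~~ (m <= m')%MM].

Definition is_binomial p : Prop :=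
  exists a b : 'X_{1..n}, a != b /\ p = 'X_[a] - 'X_[b].

End GroebnerBases.

Section SquarefreeVeronese.
Variables (K : fieldType) (r s : nat).

(* The degree bound only serves to have a finite ambient type. *)
Definition sqfree_mons : {set 'X_{1..r < s.+1}} :=
  [set u : 'X_{1..r < s.+1} | (mdeg u == s) && squarefree_mnm u].

(* The variables of T = {mpoly K[#|sqfree_mons|]} are indexed by the
   enumeration of [sqfree_mons]: 'X_i is y_u for u = [sqfree_mon i]. *)
Definition sqfree_mon (i : 'I_#|sqfree_mons|) : 'X_{1..r} :=
  bmnm (enum_val i).

Definition toric_map (p : {mpoly K[#|sqfree_mons|]}) : {mpoly K[r]} :=
  p \mPo [tuple 'X_[sqfree_mon i] | i < #|sqfree_mons|].

Definition toric_ideal (p : {mpoly K[#|sqfree_mons|]}) : Prop :=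
  toric_map p = 0.

Definition var_gt : rel 'I_#|sqfree_mons| := fun i j =>
  lex_gt (sqfree_mon i) (sqfree_mon j).

End SquarefreeVeronese.

(* Main.v *)
Require Import Defs.
From HB Require Import structures.
From mathcomp Require Import all_boot all_order all_algebra.
From mathcomp.multinomials Require Import mpoly.
From mathcomp Require Import zify.

(** A monomial [m] of T is a multiset of [s]-subsets of the [r] indices, and the
    toric map sends it to its content, the number of occurrences of each index.
    The toric ideal consists of the polynomials whose coefficients sum to zero
    over each set of monomials of given content, a fibre.  Hence the initial
    monomials of its members are the nonstandard ones, those with a smaller
    monomial in their fibre, and each element of a reduced Groebner basis is
    X^m - X^m' with [m] a minimal nonstandard monomial and [m'] the least
    monomial of its fibre ([reduced_groebner_fibred]).  It remains to show that
    each nonstandard monomial has a squarefree nonstandard divisor of degree at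
    most 3 ([nonstandard_cubic]).

    Let [m'] be smaller than [m] in the same fibre, and cancel their common
    part.  By the definition of the reverse lexicographic order, what is left of
    [m'] contains a variable [v] smaller than all variables in what is left of
    [m]; call the latter [d].  Let [u] be the smallest variable in [d].  As
    subsets, [u] and [v] agree before some index [k] which lies in [u] but not
    in [v], and [v] has an index [l] > [k] not in [u].  Then u' = u - k + l is
    smaller than [u], hence than every variable of [d], so a divisor of [d] is
    nonstandard as soon as some monomial divisible by u' has the same content
    ([nonstandard_small]).  Comparing contents, some [w] in [d] lacks [k] and
    some [z] in [d] contains [l].
    - If [w] contains [l], then u w and u' (w - l + k) have the same content; if
      [z] lacks [k], then so do u z and u' (z - l + k).
    - Otherwise [z] contains both [k] and [l] and [w] neither.  As [w] and [z]
      have the same size, [w] has an index [y] not in [z], and u w z has the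
      same content as u' (w - y + k) (z - l + y). *)

Set Implicit Arguments.
Unset Strict Implicit.
Unset Printing Implicit Defensive.

Import GRing.Theory.

(** * Orders decided at a single variable *)

(** The relation [R] is a strict partial order; reversing it gives minimal
    elements. *)
Lemma seq_maximal (T : eqType) (R : rel T) (irrR : irreflexive R)
    (trR : transitive R) (s : seq T) x0 :
  x0 \in s -> exists2 x, x \in s & forall y, y \in s -> ~~ R x y.
Proof.
elim: s x0 => // a [_ x0 _ | b s IHs x0 _].
  by exists a; rewrite ?mem_head // => y; rewrite inE => /eqP->; rewrite irrR.
have [x xs xmax] := IHs b (mem_head _ _).
case Rxa: (R x a).
  exists a => [|y]; rewrite ?mem_head // inE => /predU1P[->|ys].
    by rewrite irrR.
  by apply: contra (xmax y ys); apply: trR.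
exists x => [|y]; first by rewrite inE xs orbT.
by rewrite inE => /predU1P[->|/xmax//]; rewrite Rxa.
Qed.

Section LastDifference.
Variables (n : nat) (v : rel 'I_n).
Hypotheses (irrv : irreflexive v) (trv : transitive v).
Hypothesis totv : forall i j, i != j -> v i j || v j i.
Implicit Types a b c : 'X_{1..n}.

(** When [v i j] reads: variable [i] is larger than variable [j], the exponent
    of [a] exceeds that of [b] at the smallest variable where they differ.  This
    is the equal-degree part of [grevlex_lt v a b]. *)
Definition last_diff a b : bool :=
  [exists i : 'I_n,
     (b i < a i)%N && [forall j : 'I_n, v i j ==> (a j == b j)]].

Lemma last_diffP a b :
  reflect (exists2 i, b i < a i & forall j, v i j -> a j = b j)
          (last_diff a b).
Proof.
apply: (iffP existsP) => [[i /andP[lti /forallP eqi]]|[i lti eqi]]; exists i.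
- by [].
- by move=> j vij; apply/eqP; apply: implyP (eqi j) vij.
- by rewrite lti; apply/forallP=> j; apply/implyP=> /eqi->.
Qed.

Lemma last_diff_irr : irreflexive last_diff.
Proof. by move=> a; apply/last_diffP=> -[i]; rewrite ltnn. Qed.

Lemma last_diff_trans : transitive last_diff.
Proof.
move=> b a c /last_diffP[i ltba eqab] /last_diffP[j ltcb eqbc].
apply/last_diffP; have [eqij|neqij] := eqVneq i j.
  exists i => [|k vik]; first by rewrite (leq_trans _ ltba) // ltnW // eqij.
  by rewrite eqab // eqbc // -eqij.
case/orP: (totv neqij) => [vij|vji].
  exists j => [|k vjk]; first by rewrite eqab.
  by rewrite eqab ?eqbc //; apply: trv vij vjk.
exists i => [|k vik]; first by rewrite -eqbc.
by rewrite eqab // eqbc //; apply: trv vji vik.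
Qed.

Lemma last_diff_total a b : a != b -> last_diff a b || last_diff b a.
Proof.
move=> neqab; have [i0 /eqP neqi0]: exists i, a i != b i.
  apply/existsP; rewrite -negb_forall; apply: contra neqab => /forallP eqab.
  by apply/eqP/mnmP => i; apply/eqP.
have Di0: i0 \in [seq i <- enum 'I_n | a i != b i].
  by rewrite mem_filter mem_enum andbT; apply/eqP.
have [i] := seq_maximal irrv trv Di0.
rewrite mem_filter => /andP[neqi _] maxi.
have eqi j : v i j -> a j = b j.
  move=> vij; apply/eqP; apply: contraLR vij => neqj.
  by apply: maxi; rewrite mem_filter neqj mem_enum.
case: (ltngtP (a i) (b i)) => [lti|gti|eqab]; last by rewrite eqab eqxx in neqi.
  by apply/orP; right; apply/last_diffP; exists i => // j /eqi.
by apply/orP; left; apply/last_diffP; exists i.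
Qed.

(** Enough for [a] to precede [b]: some variable of [a] is smaller than every
    variable of [b]. *)
Lemma last_diff_small a b i :
  0 < a i -> (forall j, 0 < b j -> v j i) -> last_diff a b.
Proof.
move=> ai bi; have bi0: b i = 0.
  by apply/eqP; rewrite -leqn0 leqNgt; apply/negP=> /bi; rewrite irrv.
have neqab: a != b by apply: contraTneq ai => ->; rewrite bi0.
case/orP: (last_diff_total neqab) => // /last_diffP[j ltab eqba].
have /bi vji : 0 < b j by apply: leq_ltn_trans ltab.
by rewrite -(eqba i vji) bi0 in ai.
Qed.

Lemma grevlex_ltE a b :
  grevlex_lt v a b =
  (mdeg a < mdeg b) || (mdeg a == mdeg b) && last_diff a b.
Proof. by []. Qed.

Lemma grevlex_lt_irr : irreflexive (grevlex_lt v).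
Proof. by move=> a; rewrite grevlex_ltE ltnn eqxx last_diff_irr. Qed.

Lemma grevlex_lt_trans : transitive (grevlex_lt v).
Proof.
move=> b a c; rewrite !grevlex_ltE.
case/orP=> [ltab|/andP[/eqP-> dab]] /orP[ltbc|/andP[/eqP<- dbc]].
- by rewrite (ltn_trans ltab).
- by rewrite ltab.
- by rewrite ltbc.
- by rewrite eqxx (last_diff_trans dab dbc) orbT.
Qed.

Lemma grevlex_lt_total a b : a != b -> grevlex_lt v a b || grevlex_lt v b a.
Proof.
by move=> /last_diff_total; rewrite !grevlex_ltE; case: ltngtP.
Qed.

Lemma grevlex_lt_mdeg a b : grevlex_lt v a b -> mdeg a <= mdeg b.
Proof. by case/orP=> [/ltnW //|/andP[/eqP->]]. Qed.

End LastDifference.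

Lemma mnm_lepW n (a b : 'X_{1..n}) : (a <= b)%MM -> mdeg b <= mdeg a -> a = b.
Proof.
move=> leab; rewrite -{1}(submK leab) mdegD -{2}[mdeg a]add0n leq_add2r leqn0.
by rewrite mdeg_eq0 => /eqP ab0; rewrite -(submK leab) ab0 add0m.
Qed.

Lemma mdeg_exchange n (a b : 'X_{1..n}) (x : 'I_n) :
  mdeg a = mdeg b -> b x < a x -> exists y, a y < b y.
Proof.
move=> degab ltx; apply/existsP; apply: contraTT ltx => /existsPn leba.
suff ->: b = a by rewrite ltnn.
by apply: mnm_lepW; [apply/mnm_lepP=> y; rewrite leqNgt | rewrite degab].
Qed.

(** * Reduced Groebner bases of binomial ideals *)

(** Of a monomial order only a strict total order compatible with the degree is
    needed here, not the compatibility with products. *)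

Section FibredIdeal.
Local Open Scope ring_scope.
Variables (K : fieldType) (n : nat) (lt : rel 'X_{1..n}).
Hypotheses (irr_lt : irreflexive lt) (tr_lt : transitive lt).
Hypothesis tot_lt : forall a b, a != b -> lt a b || lt b a.
Hypothesis mdeg_lt : forall a b, lt a b -> (mdeg a <= mdeg b)%N.
Implicit Types (p g h : {mpoly K[n]}) (m a b : 'X_{1..n}).

Lemma initial_monomial_exists p :
  p != 0 -> exists m, initial_monomial lt p m.
Proof.
move=> p0; have [m0 pm0]: exists m, m \in msupp p.
  case Ep: (msupp p) => [|m s]; last by exists m; rewrite mem_head.
  by case/negP: p0; rewrite -msupp_eq0 Ep.
have [m pm maxm] := seq_maximal irr_lt tr_lt pm0.
exists m; split=> // m' pm' neqm.
by case/orP: (tot_lt neqm) => // ltmm'; case/negP: (maxm m' pm').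
Qed.

Lemma initial_monomial_uniq p a b :
  initial_monomial lt p a -> initial_monomial lt p b -> a = b.
Proof.
move=> [pa maxa] [pb maxb]; apply/eqP; apply: contraT => neqab.
have := tr_lt (maxb a pa neqab) (maxa b pb _).
by rewrite irr_lt eq_sym => ->.
Qed.

Lemma initial_ideal_monomialP (I : {mpoly K[n]} -> Prop) m :
  initial_ideal lt I 'X_[m] ->
  exists p m', [/\ I p, initial_monomial lt p m' & (m' <= m)%MM].
Proof.
case=> l lI Em; have: m \in msupp ('X_[m] : {mpoly K[n]}).
  by rewrite msuppX mem_head.
rewrite Em => {Em} ms.
have [c lc mc]: exists2 c, c \in l & m \in msupp (c.1 * c.2).
  elim: l {lI} ms => [|c l IHl]; first by rewrite big_nil msupp0.
  rewrite big_cons => /msuppD_le; rewrite mem_cat => /orP[ms|/IHl[d dl md]].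
    by exists c; rewrite ?mem_head.
  by exists d; rewrite // inE dl orbT.
have [p [m' [Ip pm' Ec]]] := lI c lc; exists p, m'; split=> //.
case/msuppM_le/allpairsP: mc => -[a b] [/= _].
rewrite Ec msuppX inE => /eqP-> ->.
exact: lem_addl.
Qed.

Lemma mem_initial_ideal (I : {mpoly K[n]} -> Prop) p m :
  I p -> initial_monomial lt p m -> initial_ideal lt I 'X_[m].
Proof.
move=> Ip pm; exists [:: (1, 'X_[m])]; last by rewrite big_seq1 mul1r.
by move=> c; rewrite inE => /eqP->; exists p, m.
Qed.

Variables (I : {mpoly K[n]} -> Prop) (T : eqType) (fib : 'X_{1..n} -> T).

(** The monomials which are not least in their fibre, the set of monomials with
    the same value of [fib].  By the hypotheses [binI] and [fibI], these are the
    initial monomials of the members of [I]. *)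
Definition nonstandard m : Prop := exists2 m', fib m' = fib m & lt m' m.

Hypothesis IB : forall p q, I p -> I q -> I (p - q).
Hypothesis binI : forall a b, fib a = fib b -> I ('X_[a] - 'X_[b]).
Hypothesis fibI : forall p m, I p -> m \in msupp p ->
  exists m', [/\ m' \in msupp p, m' != m & fib m' = fib m].

Lemma initial_nonstandard p m :
  I p -> initial_monomial lt p m -> nonstandard m.
Proof.
move=> Ip [pm maxm]; have [m' [pm' neqm Em]] := fibI Ip pm.
by exists m' => //; apply: maxm.
Qed.

Lemma initial_binomial a b :
  lt b a -> initial_monomial lt ('X_[a] - 'X_[b] : {mpoly K[n]}) a.
Proof.
move=> ltba; have neqba: b != a by apply: contraTneq ltba => ->; rewrite irr_lt.
split=> [|m].
  rewrite mcoeff_msupp mcoeffB !mcoeffX eqxx (negPf neqba) subr0.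
  exact: oner_neq0.
move=> /msuppB_le; rewrite mem_cat !msuppX !inE => /orP[/eqP->|/eqP->//].
by rewrite eqxx.
Qed.

(** The least monomial of a fibre exists because, by [mdeg_lt], a monomial
    exceeds only finitely many others. *)
Lemma standard_below m : nonstandard m ->
  exists m', [/\ fib m' = fib m, lt m' m & ~ nonstandard m'].
Proof.
case=> m1 Em1 ltm1.
pose s := [seq a <- [seq bmnm x | x : 'X_{1..n < (mdeg m).+1}] |
  (fib a == fib m) && lt a m].
have sP a : fib a = fib m -> lt a m -> a \in s.
  move=> Ea lta; rewrite mem_filter Ea eqxx lta /=.
  have dega : (mdeg a < (mdeg m).+1)%N by rewrite ltnS mdeg_lt.
  by apply/mapP; exists (BMultinom dega); rewrite ?mem_enum.
have irrR : irreflexive (fun a b => lt b a) by move=> a; rewrite irr_lt.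
have trR : transitive (fun a b => lt b a).
  by move=> b a c ltba ltcb; apply: tr_lt ltba.
have [m' sm' minm'] := seq_maximal irrR trR (sP m1 Em1 ltm1).
have /andP[/eqP Em' ltm'] : (fib m' == fib m) && lt m' m.
  by move: sm'; rewrite mem_filter => /andP[].
exists m'; split=> // -[a Ea lta]; have /minm'/negP[] // : a \in s.
by apply: sP; [rewrite Ea | apply: tr_lt ltm'].
Qed.

(** The nonleading monomials of [g] are divisible by no initial monomial of [G]:
    for other elements since [G] is reduced, for [g] itself by degree.  Hence
    they are standard, and [g] equals the binomial of its initial monomial [m]
    and the least monomial [m'] of the fibre of [m], since otherwise the
    difference would be a member of [I] with a standard initial monomial. *)
Lemma reduced_groebner_fibred (G : seq {mpoly K[n]}) g :
    reduced_groebner_basis lt I G -> g \in G ->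
  exists m m', [/\ lt m' m, g = 'X_[m] - 'X_[m'], nonstandard m
    & forall a, (a <= m)%MM -> nonstandard a -> a = m].
Proof.
case=> -[GI G0 GG] monicG redG Gg.
have divG a : nonstandard a ->
    exists h b, [/\ h \in G, initial_monomial lt h b & (b <= a)%MM].
  case=> a' Ea lta; apply: (initial_ideal_monomialP (I := fun h => h \in G)).
  apply/GG; apply: mem_initial_ideal (initial_binomial lta).
  by apply: binI; rewrite Ea.
have g0 : g != 0 by apply: contraNneq G0 => <-.
have [m gm] := initial_monomial_exists g0.
have nm := initial_nonstandard (GI g Gg) gm.
have antisym a b : (a <= b)%MM -> (b <= a)%MM -> a = b.
  move=> /mnm_lepP leab /mnm_lepP leba; apply/mnmP=> i.
  by apply/eqP; rewrite eqn_leq leab leba.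
have [m' [Em' ltm' stdm']] := standard_below nm.
have tail a : a \in msupp g -> a != m -> ~ nonstandard a.
  move=> ga neqa na; have [h [b [Gh hb leba]]] := divG a na.
  have [eqgh|neqgh] := eqVneq h g; last first.
    by case/negP: (redG h g b a Gh Gg neqgh hb ga).
  have eqbm : b = m by apply: initial_monomial_uniq gm; rewrite -eqgh.
  have lta := gm.2 a ga neqa.
  by case/eqP: neqa; apply/esym/mnm_lepW; [rewrite -eqbm | apply: mdeg_lt].
exists m, m'; split=> // [|a leam na].
  apply/eqP; rewrite -subr_eq0; apply: contraT => p0.
  have Ip : I (g - ('X_[m] - 'X_[m'])) by apply: IB; [apply: GI | apply: binI].
  have [a pa] := initial_monomial_exists p0.
  have na := initial_nonstandard Ip pa; case: pa => pa _.
  have neqa : a != m.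
    apply: contraTneq pa => ->; rewrite mcoeff_msupp negbK !mcoeffB !mcoeffX.
    rewrite (monicG g m) // eqxx.
    have /negPf-> : m' != m by apply: contraTneq ltm' => ->; rewrite irr_lt.
    by rewrite subr0 subrr.
  move: (pa) => /msuppB_le; rewrite mem_cat => /orP[ga|].
    by case: (tail a ga neqa).
  move=> /msuppB_le; rewrite mem_cat !msuppX !inE (negPf neqa) /= => /eqP eqa.
  by case: stdm'; rewrite -eqa.
have [h [b [Gh hb leba]]] := divG a na.
have lebm := lepm_trans leba leam.
have [eqgh|neqgh] := eqVneq h g; last first.
  by case/negP: (redG h g b m Gh Gg neqgh hb gm.1).
apply: antisym => //; suff <-: b = m by [].
by apply: initial_monomial_uniq gm; rewrite -eqgh.
Qed.

End FibredIdeal.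

(** * The toric ideal of the squarefree monomials *)

Section SquarefreeVeroneseFibres.
Variables (r s : nat).
Notation N := #|sqfree_mons r s|.
Implicit Types (i j u w z : 'I_N) (k l x y : 'I_r) (m a b : 'X_{1..N}).

(** The exponent of the image of 'X_[m] under the toric map, or the content of
    [m] as a multiset of [s]-subsets; the fibres are those of this map. *)
Definition fibre m : 'X_{1..r} := (\sum_(i < N) sqfree_mon i *+ m i)%MM.

Lemma fibreE m x : fibre m x = \sum_(i < N) sqfree_mon i x * m i.
Proof. by rewrite mnm_sumE; apply: eq_bigr => i _; rewrite mulmnE. Qed.

Lemma fibreD a b : fibre (a + b) = (fibre a + fibre b)%MM.
Proof.
apply/mnmP=> x; rewrite mnmDE !fibreE -big_split; apply: eq_bigr => i _ /=.
by rewrite mnmDE mulnDr.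
Qed.

Lemma fibre1 i : fibre U_(i) = sqfree_mon i.
Proof.
apply/mnmP=> x; rewrite fibreE (bigD1 i) //= mnm1E eqxx muln1 big1 ?addn0 //.
by move=> j neqj; rewrite mnm1E eq_sym (negPf neqj) muln0.
Qed.

Lemma sqfree_mon_mdeg i : mdeg (sqfree_mon i) = s.
Proof. by have := enum_valP i; rewrite inE => /andP[/eqP]. Qed.

Lemma sqfree_mon_le1 i x : sqfree_mon i x <= 1.
Proof. by have := enum_valP i; rewrite inE => /andP[_ /forallP]. Qed.

Lemma sqfree_mon_inj : injective (@sqfree_mon r s).
Proof. by move=> i j Eij; apply/enum_val_inj/val_inj. Qed.

Lemma sqfree_mon_onto (t : 'X_{1..r}) :
  mdeg t = s -> squarefree_mnm t -> exists i, sqfree_mon i = t.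
Proof.
move=> degt sqt; have bt : mdeg t < s.+1 by rewrite degt.
have tB : BMultinom bt \in sqfree_mons r s by rewrite inE /= degt eqxx.
by exists (enum_rank_in tB (BMultinom bt)); rewrite /sqfree_mon enum_rankK_in.
Qed.

Lemma mdeg_fibre m : mdeg (fibre m) = s * mdeg m.
Proof.
rewrite mdeg_sum mdegE big_distrr; apply: eq_bigr => i _ /=.
by rewrite mdegMn sqfree_mon_mdeg.
Qed.

(** The lexicographic order too is decided at a single index, the first one. *)
Lemma var_gtE i j : var_gt i j =
  last_diff (fun x y : 'I_r => y < x) (sqfree_mon i) (sqfree_mon j).
Proof. by []. Qed.

Lemma var_gt_irr : irreflexive (@var_gt r s).
Proof. by move=> i; rewrite var_gtE last_diff_irr. Qed.

Let gt_trans : transitive (fun x y : 'I_r => y < x).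
Proof. by move=> y x z ltyx ltzy; apply: ltn_trans ltyx. Qed.

Let gt_total x y : x != y -> (y < x) || (x < y).
Proof. by rewrite neq_ltn orbC. Qed.

Lemma var_gt_trans : transitive (@var_gt r s).
Proof. by move=> j i u; rewrite !var_gtE; apply: last_diff_trans. Qed.

Lemma var_gt_total i j : i != j -> var_gt i j || var_gt j i.
Proof.
rewrite -(inj_eq sqfree_mon_inj) !var_gtE.
by apply: last_diff_total gt_trans _ _ => // x; rewrite ltnn.
Qed.

Section Ideal.
Local Open Scope ring_scope.
Variable K : fieldType.

Lemma toric_mapE (p : {mpoly K[N]}) :
  toric_map p = \sum_(m <- msupp p) p@_m *: 'X_[fibre m].
Proof.
rewrite /toric_map comp_mpolyE; apply: eq_bigr => m _; congr (_ *: _).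
by rewrite /fibre -mprodXE; apply: eq_bigr => i _; rewrite tnth_mktuple mpolyXn.
Qed.

Lemma toric_mapX m : toric_map ('X_[m] : {mpoly K[N]}) = 'X_[fibre m].
Proof. by rewrite toric_mapE msuppX big_seq1 mcoeffX eqxx scale1r. Qed.

Lemma toric_idealB (p q : {mpoly K[N]}) :
  toric_ideal p -> toric_ideal q -> toric_ideal (p - q).
Proof.
by rewrite /toric_ideal /toric_map comp_mpolyB => -> ->; rewrite subr0.
Qed.

Lemma toric_ideal_binomial a b :
  fibre a = fibre b -> toric_ideal ('X_[a] - 'X_[b] : {mpoly K[N]}).
Proof.
move=> Eab; rewrite /toric_ideal /toric_map comp_mpolyB.
by rewrite -!/(toric_map _) !toric_mapX Eab subrr.
Qed.

Lemma toric_ideal_fibre (p : {mpoly K[N]}) m :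
    toric_ideal p -> m \in msupp p ->
  exists a, [/\ a \in msupp p, a != m & fibre a = fibre m].
Proof.
move=> Ip pm; have [/hasP[a pa /andP[neqa /eqP Ea]]|/hasPn only] :=
  boolP (has (fun a => (a != m) && (fibre a == fibre m)) (msupp p)).
  by exists a.
have := congr1 (mcoeff (fibre m)) Ip; rewrite toric_mapE raddf_sum mcoeff0.
rewrite (bigD1_seq m) ?msupp_uniq //= big1_seq => [|a /andP[neqa pa]].
  by rewrite mcoeffZ mcoeffX eqxx mulr1 addr0 => /eqP; rewrite mcoeff_eq0 pm.
have := only a pa; rewrite neqa /= => /negPf neqf.
by rewrite mcoeffZ mcoeffX neqf mulr0.
Qed.

End Ideal.

(** * Standard monomials of the toric ideal *)

(** As subsets: [i] with [k] replaced by [l] is again a variable. *)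
Lemma sqfree_mon_swap i k l : 0 < sqfree_mon i k -> sqfree_mon i l = 0 ->
  exists j, forall x, sqfree_mon j x + (k == x) = sqfree_mon i x + (l == x).
Proof.
move=> ik il; pose t := (sqfree_mon i - U_(k) + U_(l))%MM.
have tE x : t x + (k == x) = sqfree_mon i x + (l == x).
  rewrite mnmDE mnmBE !mnm1E; case: (eqVneq k x) ik => [<-|_ _] /=.
    by rewrite addnAC => /subnK->.
  by rewrite subn0 addn0.
have [j jt] : exists j, sqfree_mon j = t; last by exists j; rewrite jt.
apply: sqfree_mon_onto; last first.
  apply/forallP=> x; have := tE x; have := sqfree_mon_le1 i x.
  by case: (eqVneq l x) => [<-|_]; rewrite ?il; lia.
apply: (@addnI 1); rewrite -{1}(mdeg1 k) -mdegD -(sqfree_mon_mdeg i).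
rewrite -(mdeg1 l) -mdegD; congr mdeg; apply/mnmP => x.
by rewrite [LHS]mnmDE [RHS]mnmDE !mnm1E [LHS]addnC tE addnC.
Qed.

Lemma fibre_gt0 m x : 0 < fibre m x ->
  exists i, (0 < m i) && (0 < sqfree_mon i x).
Proof.
move=> mx; apply/existsP; apply: contraTT mx => /existsPn m0.
rewrite fibreE big1 // => i _; have := m0 i; lia.
Qed.

Lemma fibre_lt_mdeg m i x :
  0 < m i -> sqfree_mon i x = 0 -> fibre m x < mdeg m.
Proof.
move=> mi ix; rewrite fibreE mdegE (bigD1 i) //= [ltnRHS](bigD1 i) //= ix.
rewrite -add1n leq_add // leq_sum // => j _.
by rewrite -[leqRHS]mul1n leq_mul2r sqfree_mon_le1 orbT.
Qed.

Lemma mdeg_lt_fibre m x : fibre m x < mdeg m ->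
  exists i, (0 < m i) && (sqfree_mon i x == 0).
Proof.
move=> ltx; apply/existsP; apply: contraTT ltx => /existsPn m0.
rewrite -leqNgt fibreE mdegE leq_sum // => i _; have := m0 i.
by case: (m i) (sqfree_mon i x) => [|c] [|d] //= _; lia.
Qed.

Hypothesis s_gt0 : 0 < s.
Let ltm := grevlex_lt (@var_gt r s).

Lemma fibre_mdeg a b : fibre a = fibre b -> mdeg a = mdeg b.
Proof.
move/(congr1 (@mdeg _)); rewrite !mdeg_fibre => /eqP.
by rewrite eqn_pmul2l // => /eqP.
Qed.

(** In the reverse lexicographic order a single variable below all those of [a]
    makes [b] smaller; the degrees agree since the contents do. *)
Lemma nonstandard_small a b i : fibre b = fibre a -> 0 < b i ->
  (forall j, 0 < a j -> var_gt j i) -> nonstandard ltm fibre a.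
Proof.
move=> Eab bi ai; exists b; rewrite // /ltm grevlex_ltE (fibre_mdeg Eab) eqxx.
by rewrite (last_diff_small var_gt_irr var_gt_trans bi) ?orbT.
Qed.

Lemma nonstandard_cubic m : nonstandard ltm fibre m ->
  exists a, [/\ (a <= m)%MM, nonstandard ltm fibre a, squarefree_mnm a
              & mdeg a <= 3].
Proof.
case=> m' Em' ltm'm.
have degm : mdeg m' = mdeg m := fibre_mdeg Em'.
move: ltm'm; rewrite /ltm grevlex_ltE degm ltnn eqxx /=.
case/last_diffP => v ltv eqv.
pose d := (m - m')%MM; pose d' := (m' - m)%MM.
have dm j : 0 < d j -> 0 < m j by rewrite mnmBE; lia.
have Ed : fibre d = fibre d'.
  have: (m + d' = m' + d)%MM by apply/mnmP=> j; rewrite !mnmDE !mnmBE; lia.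
  move/(congr1 fibre); rewrite !fibreD Em' => /mnmP E; apply/mnmP=> x.
  by have := E x; rewrite !mnmDE => /addnI.
have d'v : 0 < d' v by rewrite mnmBE subn_gt0.
have dv j : 0 < d j -> var_gt j v.
  move=> dj; have neqjv : j != v.
    by apply: contraTneq dj => ->; rewrite -leqNgt mnmBE leqn0 subn_eq0 ltnW.
  case/orP: (var_gt_total neqjv) => // /eqv eqj; move: dj.
  by rewrite mnmBE eqj subnn.
have [u0 du0] : exists u, 0 < d u.
  have [x vx] : exists x, 0 < sqfree_mon v x.
    apply/existsP; apply: contraLR s_gt0 => /existsPn v0.
    rewrite -leqNgt -(sqfree_mon_mdeg v) mdegE leqn0 sum_nat_eq0.
    by apply/forallP=> x; rewrite -leqn0 leqNgt v0.
  have /fibre_gt0[u /andP[du _]] : 0 < fibre d x; last by exists u.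
  by rewrite Ed fibreE (bigD1 v) //= addn_gt0 muln_gt0 vx d'v.
have Du0 : u0 \in [seq j <- enum 'I_N | 0 < d j].
  by rewrite mem_filter du0 mem_enum.
have [u] := seq_maximal var_gt_irr var_gt_trans Du0.
rewrite mem_filter => /andP[du _] minu.
have /last_diffP[k ltk eqk] : lex_gt (sqfree_mon u) (sqfree_mon v) := dv u du.
have vk : sqfree_mon v k = 0 by have := sqfree_mon_le1 u k; lia.
have [l ltl] : exists l, sqfree_mon u l < sqfree_mon v l.
  by apply: mdeg_exchange ltk; rewrite !sqfree_mon_mdeg.
have vl : sqfree_mon v l = 1 by have := sqfree_mon_le1 v l; lia.
have ul : sqfree_mon u l = 0 by lia.
have ltkl : k < l.
  case: (ltngtP k l) => // [/eqk|/val_inj eqkl]; first by lia.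
  by rewrite eqkl in vk; lia.
have uk : 0 < sqfree_mon u k by lia.
have [u' u'E] := sqfree_mon_swap uk ul.
have ltu' : var_gt u u'.
  have neq x y : x < y -> (y == x) = false.
    by move=> ltxy; apply: contraTF ltxy => /eqP->; rewrite ltnn.
  apply/last_diffP; exists k => [|x /= ltxk].
    by have := u'E k; rewrite eqxx neq //; lia.
  have := u'E x; rewrite !neq ?addn0 //.
  by apply: ltn_trans ltkl.
have du' j : 0 < d j -> var_gt j u'.
  move=> dj; have [->//|neqju] := eqVneq j u.
  have nuj : ~~ var_gt u j by apply: minu; rewrite mem_filter dj mem_enum.
  case/orP: (var_gt_total neqju) => [|/(negP nuj)//].
  by move/var_gt_trans; apply.
have [w /andP[dw /eqP wk]] : exists w, (0 < d w) && (sqfree_mon w k == 0).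
  by apply: mdeg_lt_fibre; rewrite Ed (fibre_mdeg Ed) (fibre_lt_mdeg d'v).
have nequw : u != w by apply: contraTneq uk => ->; rewrite wk.
(* It suffices to find distinct variables of [d] whose product [a] has the
   content of some [b] divisible by u'. *)
have answer a b : (forall j, a j <= (0 < d j)) -> mdeg a <= 3 ->
    fibre b = fibre a -> 0 < b u' ->
    exists a, [/\ (a <= m)%MM, nonstandard ltm fibre a, squarefree_mnm a
                & mdeg a <= 3].
  move=> le_ad dega Eba bu'; exists a; split=> //.
  - apply/mnm_lepP=> j; apply: leq_trans (le_ad j) _.
    by case: ltnP (@dm j) => // _; apply.
  - apply: nonstandard_small Eba bu' _ => j aj; apply: du'.
    by have := leq_trans aj (le_ad j); rewrite lt0b.
  - by apply/forallP=> j; apply: leq_trans (le_ad j) (leq_b1 _).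
(* A single further variable, lacking [k] and containing [l], is enough. *)
have quadratic z : 0 < d z -> sqfree_mon z k = 0 -> 0 < sqfree_mon z l ->
    exists a, [/\ (a <= m)%MM, nonstandard ltm fibre a, squarefree_mnm a
                & mdeg a <= 3].
  move=> dz zk zl; have [z' z'E] := sqfree_mon_swap zl zk.
  have nequz : u != z by apply: contraTneq uk => ->; rewrite zk.
  apply: (answer (U_(u) + U_(z))%MM (U_(u') + U_(z'))%MM) => [j|||].
  - rewrite mnmDE !mnm1E; case: (eqVneq u j) => [<-|_].
      by rewrite eq_sym (negPf nequz) du.
    by case: eqP => [<-|]; rewrite ?dz.
  - by rewrite mdegD !mdeg1.
  - rewrite !fibreD !fibre1; apply/mnmP=> x; rewrite !mnmDE.
    by have := u'E x; have := z'E x; lia.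
  - by rewrite mnmDE !mnm1E eqxx.
have [wl|] := posnP (sqfree_mon w l); last exact: quadratic.
have [z /andP[dz zl]] : exists z, (0 < d z) && (0 < sqfree_mon z l).
  by apply: fibre_gt0; rewrite Ed fibreE (bigD1 v) //= vl mul1n addn_gt0 d'v.
have [zk|zk] := posnP (sqfree_mon z k); first exact: quadratic zl.
(* Now [z] contains [k] and [l] and [w] neither, so [w] has some [y] not in [z];
   [u], [w] and [z] pass [k], [y] and [l] round cyclically. *)
have [y lty] : exists y, sqfree_mon z y < sqfree_mon w y.
  by apply: (@mdeg_exchange _ _ _ k); rewrite ?sqfree_mon_mdeg ?wk.
have wy : 0 < sqfree_mon w y by lia.
have zy : sqfree_mon z y = 0 by have := sqfree_mon_le1 w y; lia.
have [w' w'E] := sqfree_mon_swap wy wk.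
have [z' z'E] := sqfree_mon_swap zl zy.
have nequz : u != z by apply: contraTneq zl => <-; rewrite ul.
have neqwz : w != z by apply: contraTneq zl => <-; rewrite wl.
apply: (answer (U_(u) + U_(w) + U_(z))%MM (U_(u') + U_(w') + U_(z'))%MM).
- move=> j; rewrite !mnmDE !mnm1E; case: (eqVneq u j) => [<-|_].
    by rewrite eq_sym (negPf nequw) eq_sym (negPf nequz) du.
  case: (eqVneq w j) => [<-|_]; first by rewrite eq_sym (negPf neqwz) dw.
  by case: eqP => [<-|]; rewrite ?dz.
- by rewrite !mdegD !mdeg1.
- rewrite !fibreD !fibre1; apply/mnmP=> x; rewrite !mnmDE.
  by have := u'E x; have := w'E x; have := z'E x; lia.
- by rewrite !mnmDE !mnm1E eqxx.
Qed.

End SquarefreeVeroneseFibres.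

Theorem theorem5p1 (K : fieldType) (r s : nat) (hs : (1 <= s)%N)
    (hsr : (s <= r)%N) (G : seq {mpoly K[#|sqfree_mons r s|]})
    (hG : reduced_groebner_basis (grevlex_lt (@var_gt r s))
            (@toric_ideal K r s) G) :
  forall g, g \in G ->
    [/\ is_binomial g,
        exists2 m, initial_monomial (grevlex_lt (@var_gt r s)) g m
                 & squarefree_mnm m
      & (msize g <= 4)%N].
Proof.
move=> g Gg.
have irr_lt := grevlex_lt_irr (@var_gt r s).
have tot_lt := grevlex_lt_total (@var_gt_irr r s) (@var_gt_trans r s).
have tr_lt := grevlex_lt_trans (@var_gt_trans r s) (@var_gt_total r s).
have [m [m' [ltm' -> nm minm]]] := reduced_groebner_fibred irr_lt tr_lt tot_lt
  (@grevlex_lt_mdeg _ _) (@toric_idealB r s K) (@toric_ideal_binomial r s K)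
  (@toric_ideal_fibre r s K) hG Gg.
have [a [leam na sqa dega]] := nonstandard_cubic hs nm.
have Eam : a = m by apply: minm.
rewrite {}Eam in sqa dega.
have neqm : m != m' by apply: contraTneq ltm' => ->; rewrite irr_lt.
split; first by exists m, m'.
  by exists m; first exact: initial_binomial.
rewrite msizeE; apply/bigmax_leqP_seq => b /msuppB_le.
rewrite mem_cat !msuppX !inE => /orP[] /eqP-> _ //.
by apply: leq_trans dega; apply: grevlex_lt_mdeg ltm'.
Qed.
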